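(* Let $G=\mathrm{GL}_2(\mathbb Z)$ and let \[ \mathcal M=\{(X,Y,Z)\in G^3:\ X^2+Y^2=Z^2,\ \operatorname{tr}(X)\ge 0,\ \operatorname{tr}(Y)\ge 0,\ \operatorname{tr}(Z)\ge 0\}. \] Let \[ R=\begin{pmatrix}0&-1\\1&-1\end{pmatrix},\quad U=\begin{pmatrix}-1&1\\-1&2\end{pmatrix},\quad V=\begin{pmatrix}2&-1\\3&-1\end{pmatrix},\quad W=\begin{pmatrix}1&0\\1&1\end{pmatrix}, \] and let \[ \mathcal T=\left\{\begin{pmatrix} a & -a-c \\ {a+b} & -a \end{pmatrix}:\ (a,b,c)\in\mathbb Z^3,\ ab+bc+ca=1,\ a\le b,\ a<c\right\}. \] Then \[ \mathcal M=\bigsqcup_{T\in\mathcal T}\mathcal O_G(-R^2,-R,T)\ \sqcup\ \mathcal O_G(U,V,W)\ \sqcup\ \mathcal O_G(V,U,W), \] where $\sqcup$ denotes disjoint union: all the orbits listed on the right-hand side (indexed by the distinct matrices $T\in\mathcal T$, together with the last two) are pairwise disjoint, and their union is $\mathcal M$.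
   Context: For a triple $(X,Y,Z)\in\mathcal M$, its orbit under simultaneous integral conjugation is \[ \mathcal O_G(X,Y,Z)=\{(PXP^{-1},PYP^{-1},PZP^{-1}):P\in G\}. \] *)

(* Defs.v *)
From mathcomp Require Import all_boot all_order all_algebra.
From mathcomp Require Import classical_sets.

Set Implicit Arguments.
Unset Strict Implicit.
Unset Printing Implicit Defensive.

Import Order.TTheory GRing.Theory Num.Theory.

Local Open Scope classical_set_scope.
Local Open Scope ring_scope.

Definition mx2 (a b c d : int) : 'M[int]_2 :=
  \matrix_(i < 2, j < 2)
    if i == 0 then (if j == 0 then a else b) else (if j == 0 then c else d).

(* [unitmx] over [int] is invertibility over the integers, i.e. \det = 1 or -1. *)
Definition GL2Z : set 'M[int]_2 := [set P | P \in unitmx].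

Definition triple : Type := ('M[int]_2 * 'M[int]_2 * 'M[int]_2)%type.

Definition calM : set triple :=
  [set t | let: (X, Y, Z) := t in
    [/\ GL2Z X, GL2Z Y & GL2Z Z] /\
    X ^+ 2 + Y ^+ 2 = Z ^+ 2 /\
    [/\ 0 <= \tr X, 0 <= \tr Y & 0 <= \tr Z]].

Definition conjmx2 (P X : 'M[int]_2) : 'M[int]_2 := P *m X *m invmx P.

Definition orbitG (X Y Z : 'M[int]_2) : set triple :=
  [set (conjmx2 P X, conjmx2 P Y, conjmx2 P Z) | P in GL2Z].

Definition matR : 'M[int]_2 := mx2 0 (-1) 1 (-1).
Definition matU : 'M[int]_2 := mx2 (-1) 1 (-1) 2.
Definition matV : 'M[int]_2 := mx2 2 (-1) 3 (-1).
Definition matW : 'M[int]_2 := mx2 1 0 1 1.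

Definition calT : set 'M[int]_2 :=
  [set T | exists a b c : int,
    [/\ a * b + b * c + c * a = 1, a <= b, a < c &
        T = mx2 a (- a - c) (a + b) (- a)]].

(* Main.v *)
Require Import Defs.
From mathcomp Require Import all_boot all_order all_algebra.
From mathcomp Require Import classical_sets.
From mathcomp Require Import zify ring lra.

(** By Cayley-Hamilton, X^2 + Y^2 = Z^2 reads x X + y Y - z Z = (e + f - g) I,
    where x, y, z are the traces and e, f, g the determinants of X, Y, Z; hence
    x^2 + y^2 - z^2 = 2 (e + f - g), so x and y are odd and z is even.  With
    m = tr (X adj Y), n = tr (X adj Z), l = tr (Y adj Z), taking determinants gives
    the conics
      f x^2 + e y^2 - m x y = 2 e f + 1,  g x^2 + e z^2 - n x z = 2 e g - 1,
      g y^2 + f z^2 - l y z = 2 f g - 1,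
    and det [X, zZ] = det [X, yY], det [Y, zZ] = det [Y, xX] give
      y^2 (m^2 + 1 - 2 e f) = z^2 (n^2 - 1 - 2 e g),
      x^2 (m^2 + 1 - 2 e f) = z^2 (l^2 - 1 - 2 f g).
    - e = f = 1: Vieta jumping on x^2 + y^2 - m x y = 3 leaves x = y = 1, z = 0.
    - e = f = -1: Vieta jumping leaves m = -5, and then [X, Y] has determinant -24
      and anticommutes with X - x/2, which is impossible modulo powers of 3.
    - e f = -1: a congruence mod 16 gives g = 1; for e = 1, y and z are coprime, so
      z^2 divides m^2 + 3, and a size comparison leaves x = y = 1, z = 2.
    In each case one of X, Y has trace and determinant 1, hence is conjugate to
    S = -R^2 by reduction of binary quadratic forms.  With X = S, the remaining
    matrices are Y = -R and Z of trace 0 and determinant 1, on which S acts by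
    rotating (a, b, c), or one of three explicit pairs (Y, Z) permuted by S. *)

Set Implicit Arguments.
Unset Strict Implicit.
Unset Printing Implicit Defensive.

Import Order.TTheory GRing.Theory Num.Theory.

Local Open Scope classical_set_scope.
Local Open Scope ring_scope.

(** * Quadratic Diophantine equations *)

(** Descent on x + y. For 2 <= x <= y the product x^2 - 3 of the two roots lies strictly between 0
    and y^2, so the other root lies strictly between 0 and y. At x = 1, y divides 2. *)
Lemma vieta3 (x y m : int) : 0 < x -> 0 < y ->
  x ^+ 2 + y ^+ 2 - m * x * y = 3 -> m = 1 \/ m = -1.
Proof.
have [n] := ubnP `|(x + y)%R|%N.
elim: n x y => // n IH x y le_n x0 y0 E.
wlog le_xy : x y le_n x0 y0 E / x <= y.
  by move=> H; case: (lerP x y) => h; [apply: (H x y) | apply: (H y x)]; lia.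
have [x1|x2] : x = 1 \/ 2 <= x by lia.
  subst x; have : y * (y - m) = 2 by lia.
  have [|[|]] : y = 1 \/ y = 2 \/ 3 <= y by lia.
  - by move=> ->; lia.
  - by move=> ->; lia.
  - by move=> y3 E2; case: (lerP (y - m) 0) => ?; nia.
(* The other root of the quadratic in y gives the smaller solution. *)
have prod : y * (m * x - y) = x ^+ 2 - 3 by lia.
have : 0 < m * x - y by nia.
have : m * x - y < y by nia.
move=> lt pos; apply: (IH x (m * x - y)) => //; lia.
Qed.

Lemma vieta_neg3 (x y m : int) : 0 < x -> 0 < y ->
  x ^+ 2 + y ^+ 2 + 3 = m * x * y -> m = 4 \/ m = 5.
Proof.
have [n] := ubnP `|(x + y)%R|%N.
elim: n x y => // n IH x y le_n x0 y0 E.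
wlog le_xy : x y le_n x0 y0 E / x <= y.
  by move=> H; case: (lerP x y) => h; [apply: (H x y) | apply: (H y x)]; lia.
have [x1|x2] : x = 1 \/ 2 <= x by lia.
  subst x; have : y * (m - y) = 4 by lia.
  have [|[|[|[|]]]] : y = 1 \/ y = 2 \/ y = 3 \/ y = 4 \/ 5 <= y by lia.
  - by move=> ->; lia.
  - by move=> ->; lia.
  - by move=> ->; lia.
  - by move=> ->; lia.
  - by move=> y3 E2; case: (lerP (m - y) 0) => ?; nia.
have prod : y * (m * x - y) = x ^+ 2 + 3 by lia.
(* If x = y, then x^2 divides 3, impossible for x >= 2; strictness gives x^2 + 3 < y^2. *)
have lt_xy : x < y.
  have [//|Exy] : x < y \/ x = y by lia.
  have F : x * (x * (m - 2)) = 3 by subst y; lia.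
  case: (lerP (m - 2) 0) => ?; first by nia.
  have : 4 <= x * x by nia.
  nia.
have : 0 < m * x - y by nia.
have : m * x - y < y by nia.
move=> lt pos; apply: (IH x (m * x - y)) => //; lia.
Qed.

Lemma residue3 (t : int) : exists i, [\/ t = 3 * i, t = 3 * i + 1 | t = 3 * i + 2].
Proof.
exists (t %/ 3)%Z.
have : ((t %% 3)%Z = 0) \/ ((t %% 3)%Z = 1) \/ ((t %% 3)%Z = 2) by lia.
by case=> [|[]] ?; [apply: Or31 | apply: Or32 | apply: Or33]; lia.
Qed.

(** Modulo 3 the left side is r^2 + s^2, which vanishes only at (0, 0). *)
Lemma nonresidue_mod3 (k r s t : int) :
  r ^+ 2 - (3 * k + 2) * s ^+ 2 = 3 * t ->
  (exists r', r = 3 * r') /\ exists s', s = 3 * s'.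
Proof.
have [i [] ->] := residue3 r; have [j [] ->] := residue3 s; move=> E.
all: try (exfalso; lia).
by split; [exists i | exists j].
Qed.

(* The hypotheses say that the traceless matrices [[a,b],[c,-a]] and [[u,v],[w,-u]]
   anticommute, with squares 2 mod 3 and 24. *)
Lemma anisotropic_mod3 (a b c u v w k : int) :
  a ^+ 2 + b * c = 3 * k + 2 -> u ^+ 2 + v * w = 24 ->
  2 * a * u + b * w + c * v = 0 -> False.
Proof.
move=> D N A.
(* Anticommutation turns this norm form into b^2 (u^2 + v w) = 24 b^2, so 3 divides v; [C] does the
   same for w. *)
have B : (b * u - a * v) ^+ 2 - (3 * k + 2) * v ^+ 2 = 3 * (8 * b ^+ 2).
  transitivity (b ^+ 2 * (u ^+ 2 + v * w) - b * v * (2 * a * u + b * w + c * v)).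
    by rewrite -D; ring.
  by rewrite A N; ring.
have C : (c * u - a * w) ^+ 2 - (3 * k + 2) * w ^+ 2 = 3 * (8 * c ^+ 2).
  transitivity (c ^+ 2 * (u ^+ 2 + v * w) - c * w * (2 * a * u + b * w + c * v)).
    by rewrite -D; ring.
  by rewrite A N; ring.
have [_ [v' Ev]] := nonresidue_mod3 B.
have [_ [w' Ew]] := nonresidue_mod3 C.
(* Now u^2 is 24 modulo 9, so 3 divides u, and then 9 divides 24. *)
subst v w; clear A B C D.
by have [i [] Eu] := residue3 u; subst u; lia.
Qed.

Lemma odd_vieta3 (x y m x' y' : int) :
  0 <= x -> 0 <= y -> x = 2 * x' + 1 -> y = 2 * y' + 1 ->
  (m = 1 \/ m = -1) -> x ^+ 2 + y ^+ 2 - m * x * y = 3 -> x = 1 /\ y = 1.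
Proof.
move=> x0 y0 Ex Ey [] -> E.
- have F : (2 * x - y) ^+ 2 + 3 * y ^+ 2 = 12 by lia.
  have sq := sqr_ge0 (2 * x - y).
  have y1 : y <= 1 by clear E Ex x0; nia.
  have {y1 y0 Ey sq} y1 : y = 1 by lia.
  subst y; have : x * (x - 1) = 2 by lia.
  have [|[|]] : x = 1 \/ x = 2 \/ 3 <= x by lia.
  + by lia.
  + by move=> x2; rewrite x2 in Ex; lia.
  + by nia.
- have xy := mulr_ge0 x0 y0; have x2 := sqr_ge0 x; have y2 := sqr_ge0 y.
  have F : x ^+ 2 + y ^+ 2 + x * y = 3 by lra.
  have x1 : x <= 1 by clear -F xy y2; nia.
  have y1 : y <= 1 by clear -F xy x2; nia.
  by clear -x0 y0 x1 y1 Ex Ey; lia.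
Qed.

(** Since m x y = y^2 - x^2 + 1, multiplying m^2 + 3 = z^2 h by x^2 y^2 eliminates m; the right side
    then has degree 6 and exceeds the left one unless x = 1. *)
Lemma odd_triple_eq112 (x y z m h x' y' : int) :
  0 <= x -> 0 <= y -> x = 2 * x' + 1 -> y = 2 * y' + 1 ->
  x ^+ 2 + m * x * y - y ^+ 2 = 1 -> z ^+ 2 = x ^+ 2 + y ^+ 2 + 2 -> 0 <= z ->
  m ^+ 2 + 3 = z ^+ 2 * h -> [/\ x = 1, y = 1 & z = 2].
Proof.
move=> x0 y0 Ex Ey E1 E2 z0 E3.
have h1 : 1 <= h.
  have := sqr_ge0 m; have := sqr_ge0 z; move: E3; clear.
  by move: (m ^+ 2) (z ^+ 2) => M Z *; nia.
have a1 : 1 <= x ^+ 2 by clear -Ex x0; nia.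
have b1 : 1 <= y ^+ 2 by clear -Ey y0; nia.
have key : (y ^+ 2 - x ^+ 2 + 1) ^+ 2 + 3 * (x ^+ 2 * y ^+ 2) =
   x ^+ 2 * y ^+ 2 * (x ^+ 2 + y ^+ 2 + 2) * h.
  have -> : y ^+ 2 - x ^+ 2 + 1 = m * x * y by lra.
  by rewrite -E2 -(mulrA (x ^+ 2 * y ^+ 2)) -E3; ring.
have x1 : x = 1.
  have [//|x3] : x = 1 \/ 3 <= x by lia.
  have a9 : 9 <= x ^+ 2 by clear -x3; nia.
  move: key a9 b1 h1; clear; move: (x ^+ 2) (y ^+ 2) => a b key a9 b1 h1.
  have abp : 0 <= a * b * (a + b + 2) by apply: mulr_ge0; [apply: mulr_ge0|]; lia.
  have : a * b * (a + b + 2) <= a * b * (a + b + 2) * h by rewrite ler_peMr.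
  rewrite -key => le.
  (* With h replaced by 1, right minus left is a^2 (b - 1) + b^2 (a - 1) + (a - 2) (b + 2) + 3. *)
  have : 0 <= a ^+ 2 * (b - 1) by apply: mulr_ge0; [exact: sqr_ge0 | lia].
  have : 0 <= b ^+ 2 * (a - 1) by apply: mulr_ge0; [exact: sqr_ge0 | lia].
  have : 0 <= (a - 2) * (b + 2) by apply: mulr_ge0; lia.
  by lra.
clear key E1 E3 a1 h1 b1 Ex; subst x.
have y1 : 1 <= y by lia.
have F : (z - y) * (z + y) = 3 by lra.
have z1 : y + 1 <= z by clear E2; nia.
have : z - y <= 1 by clear E2; nia.
move=> z2; have zE : z = y + 1 by lia.
by subst z; clear -F; split; lia.
Qed.

(** The square of gcd(y, z) divides 3, so y and z are coprime. *)
Lemma dvd_sqr_cofactor (y z l n M : int) : z ^+ 2 + l * y * z - y ^+ 2 = 3 ->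
  y ^+ 2 * M = z ^+ 2 * n -> exists h, M = z ^+ 2 * h.
Proof.
move=> E1 E2.
suff cop : coprimez z y.
  have /dvdzP [h ->] : (z ^+ 2 %| M)%Z.
    rewrite -(@Gauss_dvdzr _ (y ^+ 2)) ?coprimezXl ?coprimezXr // E2.
    exact: dvdz_mulr.
  by exists h; rewrite mulrC.
rewrite /coprimez.
have [z' Ez] := dvdzP (dvdz_gcdl z y).
have [y' Ey] := dvdzP (dvdz_gcdr z y).
have d0 : 0 <= gcdz z y by [].
move: (gcdz z y) Ez Ey d0 => d Ez Ey d0.
have F : d ^+ 2 * (z' ^+ 2 + l * y' * z' - y' ^+ 2) = 3 by rewrite -E1 Ez Ey; ring.
move: F d0; move: (_ - y' ^+ 2) => t; clear => F d0.
have [|[|d2]] : d = 0 \/ d = 1 \/ 2 <= d by lia.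
- by move=> d00; rewrite d00 in F; lia.
- by move=> ->.
have : 4 <= d ^+ 2 by clear F; nia.
by move: (d ^+ 2) F => D F D4; case: (lerP t 0) => ?; nia.
Qed.

(** * Invariants of a triple of 2 x 2 matrices *)

(** The coefficient of [a * b] is tr (A adj B), the polarised determinant. *)
Lemma det_lincomb (a b c p1 q1 r1 s1 p2 q2 r2 s2 : int) :
  (a * p1 + b * p2 + c) * (a * s1 + b * s2 + c)
    - (a * q1 + b * q2) * (a * r1 + b * r2)
  = a ^+ 2 * (p1 * s1 - q1 * r1) + b ^+ 2 * (p2 * s2 - q2 * r2)
    + a * b * (p1 * s2 + s1 * p2 - q1 * r2 - r1 * q2)
    + a * c * (p1 + s1) + b * c * (p2 + s2) + c ^+ 2.
Proof. by ring. Qed.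

(* Minus the determinant of the commutator of [[p1,q1],[r1,s1]] and [[p2,q2],[r2,s2]]. *)
Definition ncomm (p1 q1 r1 s1 p2 q2 r2 s2 : int) : int :=
  (q1 * r2 - q2 * r1) ^+ 2
  + ((p1 - s1) * q2 - (p2 - s2) * q1) * (r1 * (p2 - s2) - r2 * (p1 - s1)).

(** For determinants 1 this is Fricke's formula for tr (X Y X^-1 Y^-1) - 2, written with tr (X
    Y^-1). *)
Lemma ncommE (p1 q1 r1 s1 p2 q2 r2 s2 : int) :
  ncomm p1 q1 r1 s1 p2 q2 r2 s2 =
  (p1 * s2 + s1 * p2 - q1 * r2 - r1 * q2) ^+ 2
  - (p1 * s2 + s1 * p2 - q1 * r2 - r1 * q2) * (p1 + s1) * (p2 + s2)
  + (p2 * s2 - q2 * r2) * (p1 + s1) ^+ 2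
  + (p1 * s1 - q1 * r1) * (p2 + s2) ^+ 2
  - 4 * (p1 * s1 - q1 * r1) * (p2 * s2 - q2 * r2).
Proof. by rewrite /ncomm /=; ring. Qed.

Lemma ncommC (p1 q1 r1 s1 p2 q2 r2 s2 : int) :
  ncomm p1 q1 r1 s1 p2 q2 r2 s2 = ncomm p2 q2 r2 s2 p1 q1 r1 s1.
Proof. by rewrite /ncomm; ring. Qed.

(** A matrix commutes with itself and with scalars, so d [A, C] = b [A, B]; then take
    determinants. *)
Lemma ncomm_lincomb (a b c d p1 q1 r1 s1 p2 q2 r2 s2 p3 q3 r3 s3 : int) :
  d * p3 = a * p1 + b * p2 + c -> d * q3 = a * q1 + b * q2 ->
  d * r3 = a * r1 + b * r2 -> d * s3 = a * s1 + b * s2 + c ->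
  d ^+ 2 * ncomm p1 q1 r1 s1 p3 q3 r3 s3 = b ^+ 2 * ncomm p1 q1 r1 s1 p2 q2 r2 s2.
Proof.
move=> P Q R S.
transitivity (ncomm p1 q1 r1 s1 (d * p3) (d * q3) (d * r3) (d * s3)).
  by rewrite /ncomm; ring.
by rewrite P Q R S /ncomm; ring.
Qed.

Lemma trace_invariants (p1 q1 r1 s1 p2 q2 r2 s2 p3 q3 r3 s3 x y z e f g m : int) :
  p1 + s1 = x -> p2 + s2 = y -> p3 + s3 = z ->
  p1 * s1 - q1 * r1 = e -> p2 * s2 - q2 * r2 = f -> p3 * s3 - q3 * r3 = g ->
  p1 * s2 + s1 * p2 - q1 * r2 - r1 * q2 = m ->
  e ^+ 2 = 1 -> f ^+ 2 = 1 -> g ^+ 2 = 1 ->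
  z * p3 = x * p1 + y * p2 + (g - e - f) -> z * q3 = x * q1 + y * q2 ->
  z * r3 = x * r1 + y * r2 -> z * s3 = x * s1 + y * s2 + (g - e - f) ->
  [/\ z ^+ 2 = x ^+ 2 + y ^+ 2 + 2 * (g - e - f),
      f * x ^+ 2 + e * y ^+ 2 - m * x * y = 2 * e * f + 1,
      ncomm p1 q1 r1 s1 p2 q2 r2 s2 = m ^+ 2 + 1 - 2 * e * f &
      exists n l, [/\ g * x ^+ 2 + e * z ^+ 2 - n * x * z = 2 * e * g - 1,
        g * y ^+ 2 + f * z ^+ 2 - l * y * z = 2 * f * g - 1,
        y ^+ 2 * (m ^+ 2 + 1 - 2 * e * f) = z ^+ 2 * (n ^+ 2 - 1 - 2 * e * g) &
        x ^+ 2 * (m ^+ 2 + 1 - 2 * e * f) = z ^+ 2 * (l ^+ 2 - 1 - 2 * f * g)]].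
Proof.
move=> hx hy hz he hf hg hm e2 f2 g2 P Q R S.
have [n hn] : exists n : int, p1 * s3 + s1 * p3 - q1 * r3 - r1 * q3 = n by eexists.
have [l hl] : exists l : int, p2 * s3 + s2 * p3 - q2 * r3 - r2 * q3 = l by eexists.
have z2 : z ^+ 2 = x ^+ 2 + y ^+ 2 + 2 * (g - e - f).
  have : z * (p3 + s3) = x * (p1 + s1) + y * (p2 + s2) + 2 * (g - e - f) by lia.
  by rewrite hx hy hz; lia.
have nXY := ncommE p1 q1 r1 s1 p2 q2 r2 s2.
have nXZ := ncommE p1 q1 r1 s1 p3 q3 r3 s3.
have nYZ := ncommE p2 q2 r2 s2 p3 q3 r3 s3.
have cXZ : z ^+ 2 * ncomm p1 q1 r1 s1 p3 q3 r3 s3 = y ^+ 2 * ncomm p1 q1 r1 s1 p2 q2 r2 s2.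
  exact: (@ncomm_lincomb x y (g - e - f) z).
have cYZ : z ^+ 2 * ncomm p2 q2 r2 s2 p3 q3 r3 s3 = x ^+ 2 * ncomm p1 q1 r1 s1 p2 q2 r2 s2.
  rewrite [in RHS]ncommC; apply: (@ncomm_lincomb y x (g - e - f) z);
    rewrite ?P ?Q ?R ?S; ring.
(* Determinants of z Z = x X + y Y + (g - e - f) I, then of the same relation solved for - y Y and
   for - x X. *)
have dXY : z ^+ 2 * g = x ^+ 2 * e + y ^+ 2 * f + x * y * m
    + (g - e - f) * (x ^+ 2 + y ^+ 2) + (g - e - f) ^+ 2.
  transitivity ((z * p3) * (z * s3) - (z * q3) * (z * r3)); first by rewrite -hg; ring.
  rewrite P Q R S det_lincomb he hf hm hx hy; ring.
have dXZ : y ^+ 2 * f = x ^+ 2 * e + z ^+ 2 * g - x * z * n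
    + (g - e - f) * (x ^+ 2 - z ^+ 2) + (g - e - f) ^+ 2.
  transitivity ((- (y * p2)) * (- (y * s2)) - (- (y * q2)) * (- (y * r2))).
    by rewrite -hf; ring.
  have -> : - (y * p2) = x * p1 + - z * p3 + (g - e - f) by rewrite mulNr P; ring.
  have -> : - (y * s2) = x * s1 + - z * s3 + (g - e - f) by rewrite mulNr S; ring.
  have -> : - (y * q2) = x * q1 + - z * q3 by rewrite mulNr Q; ring.
  have -> : - (y * r2) = x * r1 + - z * r3 by rewrite mulNr R; ring.
  rewrite det_lincomb he hg hn hx hz; ring.
have dYZ : x ^+ 2 * e = y ^+ 2 * f + z ^+ 2 * g - y * z * l
    + (g - e - f) * (y ^+ 2 - z ^+ 2) + (g - e - f) ^+ 2.
  transitivity ((- (x * p1)) * (- (x * s1)) - (- (x * q1)) * (- (x * r1))).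
    by rewrite -he; ring.
  have -> : - (x * p1) = y * p2 + - z * p3 + (g - e - f) by rewrite mulNr P; ring.
  have -> : - (x * s1) = y * s2 + - z * s3 + (g - e - f) by rewrite mulNr S; ring.
  have -> : - (x * q1) = y * q2 + - z * q3 by rewrite mulNr Q; ring.
  have -> : - (x * r1) = y * r2 + - z * r3 by rewrite mulNr R; ring.
  rewrite det_lincomb hf hg hl hy hz; ring.
move: nXY nXZ nYZ; rewrite hx hy hz he hf hg hm hn hl => nXY nXZ nYZ.
rewrite nXZ nXY in cXZ; rewrite nYZ nXY in cYZ; rewrite nXY.
clear hx hy hz he hf hg hm hn hl P Q R S nXY nXZ nYZ.
(* These multiples of [z2] make the elimination linear for [lra]. *)
have gz2 := congr1 (fun t => g * t) z2; have ez2 := congr1 (fun t => e * t) z2.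
have fz2 := congr1 (fun t => f * t) z2.
have XY : f * x ^+ 2 + e * y ^+ 2 - m * x * y = 2 * e * f + 1 by lra.
have XZ : g * x ^+ 2 + e * z ^+ 2 - n * x * z = 2 * e * g - 1 by lra.
have YZ : g * y ^+ 2 + f * z ^+ 2 - l * y * z = 2 * f * g - 1 by lra.
clear gz2 ez2 fz2 dXY dXZ dYZ.
have E1 : m ^+ 2 - m * x * y + f * x ^+ 2 + e * y ^+ 2 - 4 * e * f
    = m ^+ 2 + 1 - 2 * e * f by lra.
have E2 : n ^+ 2 - n * x * z + g * x ^+ 2 + e * z ^+ 2 - 4 * e * g
    = n ^+ 2 - 1 - 2 * e * g by lra.
have E3 : l ^+ 2 - l * y * z + g * y ^+ 2 + f * z ^+ 2 - 4 * f * g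
    = l ^+ 2 - 1 - 2 * f * g by lra.
rewrite E1 E2 in cXZ; rewrite E1 E3 in cYZ; rewrite E1.
by split=> //; exists n, l.
Qed.

(** * Possible traces and determinants *)

Lemma parity (z : int) : exists c, z = 2 * c \/ z = 2 * c + 1.
Proof. exists (z %/ 2)%Z; lia. Qed.

(** Squares are 0 or 1 modulo 4, where z^2 = x^2 + y^2 + 2. *)
Lemma odd_sum_sqr (x y z k : int) : z ^+ 2 = x ^+ 2 + y ^+ 2 + 2 * (2 * k + 1) ->
  exists a b c, [/\ x = 2 * a + 1, y = 2 * b + 1 & z = 2 * c].
Proof.
have [a [] ->] := parity x; have [b [] ->] := parity y;
  have [c [] ->] := parity z; move=> E.
all: try (exfalso; lia).
by exists a, b, c.
Qed.

Lemma mixed_dets_traces (x y z g m n l : int) : 0 <= x -> 0 <= y -> 0 <= z ->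
  (g = 1 \/ g = -1) -> z ^+ 2 = x ^+ 2 + y ^+ 2 + 2 * g ->
  x ^+ 2 + m * x * y - y ^+ 2 = 1 ->
  y ^+ 2 * (m ^+ 2 + 3) = z ^+ 2 * (n ^+ 2 - 1 - 2 * g) ->
  g * y ^+ 2 - z ^+ 2 - l * y * z = - 2 * g - 1 ->
  [/\ x = 1, y = 1, z = 2 & g = 1].
Proof.
move=> x0 y0 z0 hg E1 E2 E3 E4.
have [k hk] : exists k, g = 2 * k + 1 by case: hg => ->; [exists 0 | exists (-1)].
have [a [b [c [xa yb zc]]]] : exists a b c, [/\ x = 2 * a + 1, y = 2 * b + 1 & z = 2 * c].
  by apply: (@odd_sum_sqr _ _ _ k); rewrite -hk.
clear k hk; case: hg => g1; subst g; last first.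
  (* For g = -1: m is odd and z^2 = x^2 + y^2 - 2 is 0 modulo 8, so 4 divides z; but y^2 (m^2 + 3)
     is 4 modulo 8. *)
  exfalso; clear E4 x0 y0 z0.
  have [t [mt|mt]] := parity m; subst; first by lia.
  have [c' [] ?] := parity c; subst; last first.
    clear E2 E3.
    have [a' [] ?] := parity a; have [b' [] ?] := parity b; subst; lia.
  clear E1 E2.
  have : (2 * b + 1) ^+ 2 * (t ^+ 2 + t + 1) = 4 * (c' ^+ 2 * (n ^+ 2 + 1)) by lra.
  by have [t' [] ?] := parity t; subst; lia.
have [h Eh] : exists h, m ^+ 2 + 3 = z ^+ 2 * h.
  apply: (@dvd_sqr_cofactor y z l (n ^+ 2 - 3)); [by lra | by rewrite E3; lra].
by have [] := odd_triple_eq112 x0 y0 xa yb E2 E1 z0 Eh.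
Qed.

(** Modulo 3 the equation reads (x - y)^2 = 0, and 3 dividing x would give 9 dividing 3. The number
    x^2 + 4 is the discriminant for trace x and determinant -1. *)
Lemma mod3_square (x y : int) : x ^+ 2 + y ^+ 2 + 3 = 5 * x * y ->
  exists k, x ^+ 2 + 4 = 3 * k + 2.
Proof.
have [i [] ->] := residue3 x; have [j [] ->] := residue3 y; move=> E.
all: try (exfalso; lia).
- by exists (3 * i ^+ 2 + 2 * i + 1); ring.
- by exists (3 * i ^+ 2 + 4 * i + 2); ring.
Qed.

Lemma trace_classification (p1 q1 r1 s1 p2 q2 r2 s2 p3 q3 r3 s3 x y z e f g : int) :
  p1 + s1 = x -> p2 + s2 = y -> p3 + s3 = z ->
  p1 * s1 - q1 * r1 = e -> p2 * s2 - q2 * r2 = f -> p3 * s3 - q3 * r3 = g ->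
  (e = 1 \/ e = -1) -> (f = 1 \/ f = -1) -> (g = 1 \/ g = -1) ->
  0 <= x -> 0 <= y -> 0 <= z ->
  z * p3 = x * p1 + y * p2 + (g - e - f) -> z * q3 = x * q1 + y * q2 ->
  z * r3 = x * r1 + y * r2 -> z * s3 = x * s1 + y * s2 + (g - e - f) ->
  [/\ x = 1, y = 1 & g = 1] /\
  [\/ [/\ e = 1, f = 1 & z = 0], [/\ e = 1, f = -1 & z = 2] | [/\ e = -1, f = 1 & z = 2]].
Proof.
move=> hx hy hz he hf hg ve vf vg x0 y0 z0 P Q R S.
have sq (t : int) : t = 1 \/ t = -1 -> t ^+ 2 = 1 by case=> ->.
have [m hm] : exists m : int, p1 * s2 + s1 * p2 - q1 * r2 - r1 * q2 = m by eexists.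
have [E1 E2 EN [n [l [XZ YZ E3 E4]]]] :=
  trace_invariants hx hy hz he hf hg hm (sq e ve) (sq f vf) (sq g vg) P Q R S.
have [k hk] : exists k, g - e - f = 2 * k + 1.
  by clear -ve vf vg; exists ((g - e - f) %/ 2)%Z; lia.
have [a [b [c [xa yb zc]]]] : exists a b c, [/\ x = 2 * a + 1, y = 2 * b + 1 & z = 2 * c].
  by apply: (@odd_sum_sqr _ _ _ k); rewrite -hk.
have D : (p1 - s1) ^+ 2 + 2 * q1 * (2 * r1) = x ^+ 2 - 4 * e by rewrite -hx -he; ring.
clear hx hy hz he hf hg hm P Q R S hk.
have xp : 0 < x by clear -xa x0; lia.
have yp : 0 < y by clear -yb y0; lia.
case: ve vf => ? [] ?; subst e f.
- clear E3 E4 D EN XZ YZ.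
  have F : x ^+ 2 + y ^+ 2 - m * x * y = 3 by lra.
  have [x1 y1] := odd_vieta3 x0 y0 xa yb (vieta3 xp yp F) F.
  rewrite x1 y1 in E1 *; clear -E1 vg z0.
  by case: vg => ?; subst g; [split=> //; apply: Or31; split=> //; nia | nia].
- have [] := @mixed_dets_traces x y z g m n l x0 y0 z0 vg.
  + by lra.
  + by lra.
  + by lra.
  + by lra.
  by move=> *; split=> //; apply: Or32.
- have [] := @mixed_dets_traces y x z g m l n y0 x0 z0 vg.
  + by lra.
  + by lra.
  + by lra.
  + by lra.
  by move=> *; split=> //; apply: Or33.
- exfalso; clear E3 E4 XZ YZ.
  have F : x ^+ 2 + y ^+ 2 + 3 = (- m) * x * y by lra.
  (* For - m = 4 and odd x, y the two sides of [F] have opposite parity. *)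
  have [m4|m5] := vieta_neg3 xp yp F.
    by rewrite m4 xa yb in F; clear -F; lia.
  rewrite m5 in F.
  have [k' Ek] := mod3_square F.
  (* The two matrices are 2 X - x I, of square x^2 + 4, and [X, Y], of square m^2 - 1 = 24. *)
  apply: (@anisotropic_mod3 (p1 - s1) (2 * q1) (2 * r1) (q1 * r2 - q2 * r1)
    ((p1 - s1) * q2 - (p2 - s2) * q1) (r1 * (p2 - s2) - r2 * (p1 - s1)) k').
  + by rewrite D -Ek; ring.
  + have Em : m = -5 by rewrite -m5 opprK.
    by rewrite -/(ncomm p1 q1 r1 s1 p2 q2 r2 s2) EN Em.
  + by ring.
Qed.

(** * Conjugation of integral matrices *)

Lemma mx2P (A : 'M[int]_2) : exists a b c d, A = mx2 a b c d.
Proof.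
exists (A 0 0), (A 0 1), (A 1 0), (A 1 1).
apply/matrixP => i j; rewrite mxE.
by case: i j => [[|[|//]] ?] [[|[|//]] ?]; congr (A _ _); apply: val_inj.
Qed.

Lemma mx2_inj a b c d a' b' c' d' :
  mx2 a b c d = mx2 a' b' c' d' -> [/\ a = a', b = b', c = c' & d = d'].
Proof.
by move/matrixP => H; move: (H 0 0) (H 0 1) (H 1 0) (H 1 1); rewrite !mxE.
Qed.

Lemma mulmx2 a b c d a' b' c' d' : mx2 a b c d *m mx2 a' b' c' d' =
  mx2 (a * a' + b * c') (a * b' + b * d') (c * a' + d * c') (c * b' + d * d').
Proof.
apply/matrixP => i j; rewrite !mxE big_ord_recl big_ord1 !mxE /=.
by case: i j => [[|[|//]] ?] [[|[|//]] ?].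
Qed.

Lemma addmx2 a b c d a' b' c' d' : mx2 a b c d + mx2 a' b' c' d' =
  mx2 (a + a') (b + b') (c + c') (d + d').
Proof.
by apply/matrixP => i j; rewrite !mxE; do 2?case: ifP.
Qed.

Lemma oppmx2 a b c d : - mx2 a b c d = mx2 (- a) (- b) (- c) (- d).
Proof. by apply/matrixP => i j; rewrite !mxE; do 2?case: ifP. Qed.

Lemma trmx2 a b c d : \tr (mx2 a b c d) = a + d.
Proof. by rewrite /mxtrace big_ord_recl big_ord1 !mxE. Qed.

Lemma detmx2 a b c d : \det (mx2 a b c d) = a * d - b * c.
Proof.
rewrite (expand_det_row _ 0) big_ord_recl big_ord1 /cofactor !det_mx11 !mxE /=.
by rewrite expr0 expr1 mul1r mulN1r mulrN.
Qed.

Lemma conjmx2P (P X X' : 'M[int]_2) : GL2Z P ->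
  conjmx2 P X = X' <-> P *m X = X' *m P.
Proof.
by move=> uP; rewrite /conjmx2; split=> [<- | ->]; rewrite ?mulmxKV ?mulmxK.
Qed.

Lemma conjmx2E (P X : 'M[int]_2) : GL2Z P -> conjmx2 P X *m P = P *m X.
Proof. by move=> uP; rewrite /conjmx2 mulmxKV. Qed.

Lemma GL2Z_mul (P Q : 'M[int]_2) : GL2Z P -> GL2Z Q -> GL2Z (P *m Q).
Proof. by rewrite /GL2Z /= => uP uQ; rewrite unitmx_mul uP. Qed.

Lemma GL2Z_inv (P : 'M[int]_2) : GL2Z P -> GL2Z (invmx P).
Proof. by rewrite /GL2Z /= unitmx_inv. Qed.

Lemma GL2Z_mx2 a b c d :
  GL2Z (mx2 a b c d) <-> a * d - b * c = 1 \/ a * d - b * c = -1.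
Proof.
rewrite /GL2Z /=; rewrite unitmxE detmx2; split=> [/orP[] /eqP|[] ->] //; by [left|right].
Qed.

Lemma conjmx2M (P Q X : 'M[int]_2) : GL2Z P -> GL2Z Q ->
  conjmx2 P (conjmx2 Q X) = conjmx2 (P *m Q) X.
Proof.
move=> uP uQ; apply/esym; apply/(conjmx2P _ _ (GL2Z_mul uP uQ)).
by rewrite mulmxA conjmx2E // -[RHS]mulmxA conjmx2E // mulmxA.
Qed.

Lemma conj1mx2 (X : 'M[int]_2) : conjmx2 1%:M X = X.
Proof. by rewrite /conjmx2 mul1mx invmx1 mulmx1. Qed.

Lemma conjmx2K (P X : 'M[int]_2) : GL2Z P -> conjmx2 (invmx P) (conjmx2 P X) = X.
Proof.
by move=> uP; rewrite conjmx2M ?mulVmx ?conj1mx2 //; apply: GL2Z_inv.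
Qed.

Lemma mxtrace_conj (P X : 'M[int]_2) : GL2Z P -> \tr (conjmx2 P X) = \tr X.
Proof. by move=> uP; rewrite /conjmx2 mxtrace_mulC mulmxA mulVmx ?mul1mx. Qed.

Lemma det_conj (P X : 'M[int]_2) : GL2Z P -> \det (conjmx2 P X) = \det X.
Proof.
by move=> uP; rewrite /conjmx2 !det_mulmx mulrAC -det_mulmx mulmxV // det1 mul1r.
Qed.

Lemma conjmx2D (P X Y : 'M[int]_2) : conjmx2 P (X + Y) = conjmx2 P X + conjmx2 P Y.
Proof. by rewrite /conjmx2 mulmxDr mulmxDl. Qed.

Lemma conjmx2_sqr (P X : 'M[int]_2) : GL2Z P -> conjmx2 P (X ^+ 2) = conjmx2 P X ^+ 2.
Proof.
by move=> uP; rewrite /conjmx2 !expr2 -!mulmxE !mulmxA mulmxKV.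
Qed.

Lemma calM_conj (P X Y Z : 'M[int]_2) : GL2Z P -> calM (X, Y, Z) ->
  calM (conjmx2 P X, conjmx2 P Y, conjmx2 P Z).
Proof.
move=> uP [[uX uY uZ] [E [x0 y0 z0]]]; split; last first.
  by rewrite -!conjmx2_sqr // -conjmx2D E !mxtrace_conj.
by rewrite /GL2Z /= !unitmxE !det_conj // -!unitmxE.
Qed.

Lemma orbitG_conj (P X Y Z : 'M[int]_2) : GL2Z P ->
  orbitG (conjmx2 P X) (conjmx2 P Y) (conjmx2 P Z) (X, Y, Z).
Proof.
by move=> uP; exists (invmx P); [exact: GL2Z_inv | rewrite !conjmx2K].
Qed.

(** * Reduction of matrices of trace and determinant 1 *)

Definition matS := mx2 1 (-1) 1 0.

Lemma centered_residue (u r : int) : r != 0 -> exists s, - `|r| <= u + 2 * (s * r) <= `|r|.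
Proof.
move=> r0.
have r2 : 0 < 2 * `|r| by lia.
have E := divz_eq (u + `|r|) (2 * `|r|).
have L := modz_ge0 (u + `|r|) (lt0r_neq0 r2).
have U := ltz_pmod (u + `|r|) r2.
move: (_ %/ _)%Z (_ %% _)%Z E L U => k t E L U.
by case: (lerP 0 r) => s0; [exists (- k) | exists k]; nia.
Qed.

(** Gauss reduction in discriminant -3, by descent on |r|: once |2 p' - 1| <= |r|, 4 |q' r| = (2 p'
    - 1)^2 + 3 < 4 r^2, so exchanging q' and r descends. *)
Lemma order6_conj_mx2 (p q r : int) : p * (1 - p) - q * r = 1 ->
  exists2 P, GL2Z P & P *m mx2 p q r (1 - p) = matS *m P.
Proof.
have [n] := ubnP `|r|%N.
elim: n p q r => // n IH p q r le_n E.
have [r0|[r1|[r1|r2]]] : r = 0 \/ r = 1 \/ r = -1 \/ 2 <= `|r| by clear; lia.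
- by exfalso; subst r; clear -E; nia.
- exists (mx2 1 (1 - p) 0 1); first by apply/GL2Z_mx2; lia.
  have -> : q = p * (1 - p) - 1 by subst r; lia.
  by subst r; rewrite !mulmx2; congr mx2; ring.
- exists (mx2 1 (p - 1) 0 (-1)); first by apply/GL2Z_mx2; lia.
  have -> : q = 1 - p * (1 - p) by subst r; lia.
  by subst r; rewrite !mulmx2; congr mx2; ring.
have [|s /andP[s1 s2]] := @centered_residue (2 * p - 1) r; first by lia.
(* Entries after conjugation by the unipotent [[1, s], [0, 1]]. *)
pose p' := p + s * r; pose q' := q + s * (1 - 2 * p) - s ^+ 2 * r.
have E' : p' * (1 - p') - q' * r = 1 by rewrite /p' /q' -[RHS]E; ring.
have lt_q : `|q'| < `|r|.
  have Eq : q' * r = p' * (1 - p') - 1 by lra.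
  have U : -`|r| <= 2 * p' - 1 <= `|r| by rewrite /p'; lia.
  have N : 4 * (`|q'| * `|r|) = (2 * p' - 1) ^+ 2 + 3.
    rewrite -normrM Eq ler0_norm; last by clear; nia.
    by ring.
  case: ltrP => // le_rq; exfalso.
  move: (`|r|) (`|q'|) (2 * p' - 1) r2 U N le_rq; clear => R Q u R2 /andP[u1 u2] N le.
  have : u ^+ 2 <= R ^+ 2 by clear N le R2; nia.
  have : R * R <= Q * R by rewrite ler_wpM2r //; lia.
  have : 4 <= R ^+ 2 by clear -R2; nia.
  by lra.
have [||P uP HP] := IH (1 - p') r q'.
- by clear -le_n lt_q; lia.
- by rewrite -[RHS]E'; ring.
(* This factor is that unipotent followed by the swap of the basis vectors. *)
exists (P *m mx2 0 1 1 s).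
  by apply: GL2Z_mul => //; apply/GL2Z_mx2; lia.
rewrite mulmxA -HP -!mulmxA; congr (_ *m _).
by rewrite !mulmx2; congr mx2; rewrite /p' /q'; ring.
Qed.

Lemma order6_conj (X : 'M[int]_2) : \tr X = 1 -> \det X = 1 ->
  exists2 P, GL2Z P & conjmx2 P X = matS.
Proof.
have [p [q [r [s ->]]]] := mx2P X; rewrite trmx2 detmx2 => T D.
have -> : s = 1 - p by lia.
have [|P uP HP] := @order6_conj_mx2 p q r; first by rewrite -[RHS]D; congr (_ * _ - _); lia.
by exists P => //; apply/conjmx2P.
Qed.

(** * Normal forms of the triples *)

Lemma sqr_mx2 a b c d : mx2 a b c d ^+ 2 =
  mx2 (a * a + b * c) (a * b + b * d) (c * a + d * c) (c * b + d * d).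
Proof. by rewrite expr2 -mulmxE mulmx2. Qed.

Lemma calM_mx2 (p1 q1 r1 s1 p2 q2 r2 s2 p3 q3 r3 s3 : int) :
  calM (mx2 p1 q1 r1 s1, mx2 p2 q2 r2 s2, mx2 p3 q3 r3 s3) ->
  exists e f z, [/\ p1 * s1 - q1 * r1 = e, p2 * s2 - q2 * r2 = f,
    p3 * s3 - q3 * r3 = 1 & [/\ p1 + s1 = 1, p2 + s2 = 1 & p3 + s3 = z]] /\
  [/\ z * p3 = p1 + p2 + (1 - e - f), z * q3 = q1 + q2,
      z * r3 = r1 + r2 & z * s3 = s1 + s2 + (1 - e - f)] /\
  [\/ [/\ e = 1, f = 1 & z = 0], [/\ e = 1, f = -1 & z = 2] | [/\ e = -1, f = 1 & z = 2]].
Proof.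
move=> [[/GL2Z_mx2 uX /GL2Z_mx2 uY /GL2Z_mx2 uZ] [E]].
rewrite !trmx2 => -[x0 y0 z0].
move: E; rewrite !sqr_mx2 addmx2 => /mx2_inj [P Q R S].
(* Cayley-Hamilton entrywise: p^2 + q r = (p + s) p - det makes the equation linear. *)
have [||||[x1 y1 g1] H] := trace_classification (erefl (p1 + s1)) (erefl (p2 + s2))
  (erefl (p3 + s3)) erefl erefl erefl uX uY uZ x0 y0 z0; [lra | lra | lra | lra |].
exists (p1 * s1 - q1 * r1), (p2 * s2 - q2 * r2), (p3 + s3); split=> //.
split=> //; clear uX uY uZ H x0 y0 z0.
by rewrite -g1; split; [move: P|move: Q|move: R|move: S];
  have -> : s1 = 1 - p1 by [lra]; have -> : s2 = 1 - p2 by [lra]; move=> ?; lra.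
Qed.

Lemma oppR2 : - (matR ^+ 2) = matS.
Proof. by rewrite sqr_mx2 oppmx2. Qed.

Lemma oppR : - matR = mx2 0 1 (-1) 1.
Proof. by rewrite oppmx2. Qed.

(** Coordinates on traceless matrices in which the determinant is ab + bc + ca and conjugation by
    [matS] is a cyclic rotation. *)
Definition matT (a b c : int) := mx2 a (- a - c) (a + b) (- a).

Lemma matS_rot a b c : matS *m matT a b c = matT c a b *m matS.
Proof. by rewrite !mulmx2; congr mx2; ring. Qed.

Lemma GL2Z_S : GL2Z matS.
Proof. by apply/GL2Z_mx2; left. Qed.

(** The entries are not all equal, since 3 a^2 = 1 has no solution. *)
Lemma min_rotation (a b c : int) : a * b + b * c + c * a = 1 ->
  [\/ a <= b /\ a < c, b <= c /\ b < a | c <= a /\ c < b].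
Proof.
move=> E; have [E1|N] : (a = b /\ b = c) \/ (a != b) \/ (b != c) by clear; lia.
  by exfalso; case: E1 => *; subst; lia.
have : (a <= b /\ a < c) \/ (b <= c /\ b < a) \/ (c <= a /\ c < b) by clear E; lia.
by case=> [|[]] ?; [apply: Or31 | apply: Or32 | apply: Or33].
Qed.

(** As - R = S^-1, every power of S fixes S and - R; the power used rotates (a, b, c) into the range
    of [calT]. *)
Lemma conj_calT (p q r : int) : - p * p - q * r = 1 ->
  exists2 P, GL2Z P & [/\ conjmx2 P matS = matS,
    conjmx2 P (- matR) = - matR & calT (conjmx2 P (mx2 p q r (- p)))].
Proof.
move=> E; pose a := p; pose b := r - p; pose c := - q - p.
have abc : a * b + b * c + c * a = 1 by rewrite /a /b /c; lra.
have -> : mx2 p q r (- p) = matT a b c by congr mx2; rewrite /a /b /c; ring.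
have SR : matS *m (- matR) = - matR *m matS by rewrite oppR !mulmx2.
have cR : conjmx2 matS (- matR) = - matR by apply/(conjmx2P _ _ GL2Z_S).
have cS : conjmx2 matS matS = matS by apply/(conjmx2P _ _ GL2Z_S).
have cT a' b' c' : conjmx2 matS (matT a' b' c') = matT c' a' b'.
  by apply/(conjmx2P _ _ GL2Z_S); apply: matS_rot.
have [] := min_rotation abc => -[le lt].
- by exists 1%:M; [exact: unitmx1 | rewrite !conj1mx2; split=> //; exists a, b, c].
- exists (matS *m matS); first exact: GL2Z_mul GL2Z_S GL2Z_S.
  rewrite -!conjmx2M ?cR ?cS ?cT //; try exact: GL2Z_S.
  by split=> //; exists b, c, a; split=> //; rewrite -abc; ring.
- exists matS; first exact: GL2Z_S.
  rewrite cR cS cT; split=> //; exists c, a, b; split=> //; rewrite -abc; ring.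
Qed.

(** This is the norm form of the Eisenstein integers; only its six units take the value 1, and -1 is
    not a value. *)
Lemma det_cube_root (u v : int) : u * (u + v) + v * v = 1 \/ u * (u + v) + v * v = -1 ->
  [\/ v = 0, u = 0 | u = - v].
Proof.
move=> H.
have {H} E : u * (u + v) + v * v = 1 by case: H => // H; exfalso; nia.
have u1 : -1 <= u <= 1 by nia.
have v1 : -1 <= v <= 1 by nia.
have uc : u = -1 \/ u = 0 \/ u = 1 by clear E v1; lia.
have vc : v = -1 \/ v = 0 \/ v = 1 by clear E u1; lia.
have : v = 0 \/ u = 0 \/ u = - v by clear u1 v1; case: uc vc => [|[]] ? [|[]] ?; subst; lia.
by case=> [|[]] ?; [apply: Or31 | apply: Or32 | apply: Or33].
Qed.

(** The centraliser of S consists of the units of Z[S], that is, of the matrices S^k up to sign.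
    They rotate (a, b, c), and the inequalities of [calT] exclude a nontrivial rotation. *)
Lemma calT_conj_unique (K T T' : 'M[int]_2) : GL2Z K -> K *m matS = matS *m K ->
  K *m T = T' *m K -> calT T -> calT T' -> T = T'.
Proof.
have [u [v [w [t ->]]]] := mx2P K; move=> /GL2Z_mx2 uK.
rewrite !mulmx2 => /mx2_inj [h1 h2 h3 h4] KT.
move=> [a [b [c [E ab ac TE]]]] [a' [b' [c' [E' ab' ac' TE']]]].
have {h1 h3} Ew : w = - v by lia.
have {h2 h4} Et : t = u + v by lia.
subst w t T T'; move: KT; rewrite !mulmx2 => /mx2_inj [H1 H2 H3 H4].
have uv : [\/ v = 0, u = 0 | u = - v].
  by apply: det_cube_root; case: uK => H; [left | right]; lra.
suff [-> -> ->] : [/\ a = a', b = b' & c = c'] by [].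
have pm (k : int) : k * k = 1 -> k = 1 \/ k = -1 by clear; nia.
have det1 : u * (u + v) + v * v = 1 by clear -uK; nia.
case: uv => ?; subst; [have := pm u | have := pm v | have := pm v].
all: case; [lra | | ] => ?; subst; clear uK det1 E E'; split; lia.
Qed.

Lemma mixed_conj (X Y Z : 'M[int]_2) : calM (X, Y, Z) \/ calM (Y, X, Z) ->
  \det X = 1 -> \det Y = -1 ->
  exists2 P, GL2Z P & [/\ conjmx2 P X = matV, conjmx2 P Y = matU & conjmx2 P Z = matW].
Proof.
wlog -> : X Y Z / X = matS.
  move=> H cM dX dY.
  have tX : \tr X = 1.
    have [p [q [r [s XE]]]] := mx2P X; have [p' [q' [r' [s' YE]]]] := mx2P Y.
    have [p3 [q3 [r3 [s3 ZE]]]] := mx2P Z; subst X Y Z; rewrite trmx2.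
    by case: cM => /calM_mx2 [e [f [z [[_ _ _ []]]]]].
  have [P uP PX] := order6_conj tX dX.
  have [||||Q uQ [QX QY QZ]] := H (conjmx2 P X) (conjmx2 P Y) (conjmx2 P Z).
  - exact: PX.
  - by case: cM => /(calM_conj uP); [left | right].
  - by rewrite det_conj.
  - by rewrite det_conj.
  exists (Q *m P); first exact: GL2Z_mul.
  by rewrite -!conjmx2M.
have [p [q [r [s ->]]]] := mx2P Y; have [p3 [q3 [r3 [s3 ->]]]] := mx2P Z.
rewrite detmx2 => cM _ dY.
have [tY [g1 [P3 Q3 [R3 S3]]]] : p + s = 1 /\ p3 * s3 - q3 * r3 = 1 /\
    [/\ 2 * p3 = p + 2, 2 * q3 = q - 1 & 2 * r3 = r + 1 /\ 2 * s3 = s + 1].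
  by case: cM => /calM_mx2 [e [f [z [[he hf hg [tx ty tz]] [[P Q R S] V]]]]];
   case: V => -[e1 f1 z1]; rewrite e1 f1 z1 in he hf P Q R S; repeat split; lia.
(* The determinant of 2 Z = S + Y + I. *)
have rE : r = p + q.
  have F : (2 * p3) * (2 * s3) - (2 * q3) * (2 * r3) = 4.
    by transitivity (4 * (p3 * s3 - q3 * r3)); [ring | rewrite g1].
  have sE : s = 1 - p by lia.
  by rewrite P3 Q3 R3 S3 sE in F; rewrite sE in dY; clear -F dY; lra.
have sE : s = 1 - p by lia.
subst r s; clear cM tY.
have sol : (p = 0 /\ q = 1) \/ (p = 0 /\ q = -1) \/ (p = 2 /\ q = -1).
  have F : p ^+ 2 + p * q + q ^+ 2 - p = 1 by lra.
  (* From (2 q + p)^2 = 4 + 4 p - 3 p^2 only p = 0, 1, 2 remain. *)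
  have sq := sqr_ge0 (2 * q + p).
  have pb : 0 <= p <= 2 by clear -F sq; nia.
  have [|[|]] : p = 0 \/ p = 1 \/ p = 2 by lia.
  - by move=> p0; subst p; clear -F; nia.
  - by move=> p1; subst p; clear -F; have [k [] ?] := parity q; subst q; lia.
  - move=> p2; subst p; have : (q + 1) ^+ 2 == 0 by apply/eqP; lra.
    by rewrite sqrf_eq0 => /eqP; lia.
(* With A = [[1, 0], [1, 1]], which conjugates S to V, the conjugators are A, A S^2 and A S. *)
case: sol => [|[]] [? ?]; subst p q.
- have uP : GL2Z (mx2 1 0 1 1) by apply/GL2Z_mx2; left.
  by exists (mx2 1 0 1 1) => //;
  split; apply/(conjmx2P _ _ uP); rewrite !mulmx2; congr mx2; lia.
- have uP : GL2Z (mx2 0 (-1) 1 (-2)) by apply/GL2Z_mx2; left.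
  by exists (mx2 0 (-1) 1 (-2)) => //;
  split; apply/(conjmx2P _ _ uP); rewrite !mulmx2; congr mx2; lia.
- have uP : GL2Z (mx2 1 (-1) 2 (-1)) by apply/GL2Z_mx2; left.
  by exists (mx2 1 (-1) 2 (-1)) => //;
  split; apply/(conjmx2P _ _ uP); rewrite !mulmx2; congr mx2; lia.
Qed.

(** * Covering and disjointness of the orbits *)

Lemma calM_base : [/\ forall T, calT T -> calM (matS, - matR, T),
  calM (matU, matV, matW) & calM (matV, matU, matW)].
Proof.
rewrite oppR; split.
- move=> T [a [b [c [E _ _ ->]]]]; split; first by split; apply/GL2Z_mx2; lia.
  by rewrite !sqr_mx2 addmx2 !trmx2; split=> //; [congr mx2; lra | split; lia].
- split; first by split; apply/GL2Z_mx2; lia.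
  by rewrite !sqr_mx2 addmx2 !trmx2; split.
- split; first by split; apply/GL2Z_mx2; lia.
  by rewrite !sqr_mx2 addmx2 !trmx2; split.
Qed.

Lemma orbitG_calM X Y Z : calM (X, Y, Z) -> orbitG X Y Z `<=` calM.
Proof. by move=> cM t [P uP <-]; apply: calM_conj. Qed.

(** Separates the three families, whose first two determinants are (1, 1), (-1, 1) and (1, -1). *)
Lemma orbitG_det_disjoint X Y Z X' Y' Z' : \det X != \det X' \/ \det Y != \det Y' ->
  orbitG X Y Z `&` orbitG X' Y' Z' = set0.
Proof.
move=> dN; apply/seteqP; split=> // t [[P uP <-] [Q uQ [EX EY _]]].
have := congr1 determinant EX; have := congr1 determinant EY.
by rewrite !det_conj // => E1 E2; case: dN => /eqP; rewrite ?E1 ?E2.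
Qed.

Lemma calM_orbits X Y Z : calM (X, Y, Z) ->
  [\/ exists2 T, calT T & orbitG matS (- matR) T (X, Y, Z),
      orbitG matU matV matW (X, Y, Z) | orbitG matV matU matW (X, Y, Z)].
Proof.
move=> cM.
have [p1 [q1 [r1 [s1 XE]]]] := mx2P X; have [p2 [q2 [r2 [s2 YE]]]] := mx2P Y.
have [p3 [q3 [r3 [s3 ZE]]]] := mx2P Z; move: (cM); rewrite XE YE ZE => /calM_mx2.
move=> [e [f [z [[he hf _ [tx _ _]] [_ V]]]]].
have dX : \det X = e by rewrite XE detmx2.
have dY : \det Y = f by rewrite YE detmx2.
have tX : \tr X = 1 by rewrite XE trmx2.
rewrite -XE -YE -ZE; clear XE YE ZE he hf tx.
case: V => -[e1 f1 z1]; rewrite e1 in dX; rewrite f1 in dY.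
- apply: Or31.
  have [P uP PX] := order6_conj tX dX.
  have := calM_conj uP cM; rewrite PX.
  have [p [q [r [s YE]]]] := mx2P (conjmx2 P Y).
  have [p' [q' [r' [s' ZE]]]] := mx2P (conjmx2 P Z).
  rewrite YE ZE => /calM_mx2 [e' [f' [z' [[he hf hg [tx' ty' tz']] [[P3 Q3 R3 S3] V']]]]].
  have fE : f' = 1 by rewrite -hf -detmx2 -YE det_conj.
  have zE : z' = 0 by case: V' => -[]; lia.
  (* For e = f = 1 and z = 0 the linear relation reads Y = I - S, which is - R. *)
  have YR : conjmx2 P Y = - matR by rewrite YE oppR; congr mx2; subst z' f'; lia.
  have sE : s' = - p' by lia.
  have [|Q uQ [QS QR QT]] := @conj_calT p' q' r'; first by rewrite -hg sE; ring.
  exists (conjmx2 Q (mx2 p' q' r' (- p'))) => //.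
  have := orbitG_conj X Y Z (GL2Z_mul uQ uP).
  by rewrite -!conjmx2M // PX QS YR QR ZE sE.
- apply: Or33; have [|P uP [PX PY PZ]] := mixed_conj (X := X) (Y := Y) (Z := Z) _ dX dY.
    by left.
  by rewrite -PX -PY -PZ; apply: orbitG_conj.
- apply: Or32; have [|P uP [PX PY PZ]] := mixed_conj (X := Y) (Y := X) (Z := Z) _ dY dX.
    by right.
  by rewrite -PX -PY -PZ; apply: orbitG_conj.
Qed.

Theorem theorem1p1 :
  [/\ calM = (\bigcup_(T in calT) orbitG (- (matR ^+ 2)) (- matR) T)
             `|` orbitG matU matV matW `|` orbitG matV matU matW,
      forall T T' : 'M[int]_2, calT T -> calT T' -> T <> T' ->
        orbitG (- (matR ^+ 2)) (- matR) T
          `&` orbitG (- (matR ^+ 2)) (- matR) T' = set0,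
      forall T : 'M[int]_2, calT T ->
        orbitG (- (matR ^+ 2)) (- matR) T `&` orbitG matU matV matW = set0,
      forall T : 'M[int]_2, calT T ->
        orbitG (- (matR ^+ 2)) (- matR) T `&` orbitG matV matU matW = set0 &
      orbitG matU matV matW `&` orbitG matV matU matW = set0].
Proof.
have [baseT baseUV baseVU] := calM_base.
rewrite oppR2; split.
- apply/seteqP; split=> [[[X Y] Z] /calM_orbits [[T cT oT]|o|o] | t [[[T cT]|]|]].
  + by left; left; exists T.
  + by left; right.
  + by right.
  + exact: orbitG_calM (baseT T cT) _.
  + exact: orbitG_calM baseUV _.
  + exact: orbitG_calM baseVU _.
- move=> T T' cT cT' neqT; apply/seteqP; split=> // t [[P uP <-] [Q uQ [ES _ ET]]].
  (* A common element makes Q^-1 P centralise S and conjugate T to T'. *)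
  have uK := GL2Z_mul (GL2Z_inv uQ) uP; apply: neqT.
  have KE A : conjmx2 (invmx Q *m P) A = conjmx2 (invmx Q) (conjmx2 P A).
    by rewrite conjmx2M //; apply: GL2Z_inv.
  apply: (calT_conj_unique uK) => //; apply/(conjmx2P _ _ uK); rewrite KE.
    by rewrite -ES conjmx2K.
  by rewrite -ET conjmx2K.
- by move=> T _; apply: orbitG_det_disjoint; left; rewrite !detmx2.
- by move=> T _; apply: orbitG_det_disjoint; right; rewrite oppR !detmx2.
- by apply: orbitG_det_disjoint; left; rewrite !detmx2.
Qed.
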